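(* Let $f:\mathbb{R}^d\to\mathbb{R}$ be twice continuously differentiable and bounded below, with gradient $g(x)=\nabla f(x)$ and Hessian $H(x)=\nabla^2 f(x)$. Assume there exists $0\le L_2<\infty$ such that for all $x\in\mathbb{R}^d$ and all $t\ge 0$, $$\|H(x-t\,g(x))-H(x)\|\le t\,L_2\|g(x)\|.$$ Let $\rho\in(0,1/2)$, $\sigma>0$, $s^{\rm LPC}_{\min}\in(0,1/\sigma)$ and $0<s^{\rm NC}_{\min}\le s^{\rm NC}_{\max}<\infty$. Let $x\in\mathbb{R}^d$, and let $p$ be any direction returned by the Hessian-aware scaling selection (defined in the context) with inputs $g=g(x)$, $H=H(x)$, $\sigma$. If $$\|g(x)\|\le \min\left\{\frac{6\sigma^2(1/2-\rho)}{L_2},\ \frac{6(1-\rho)}{L_2\,(s^{\rm NC}_{\max})^2}\right\},$$ then the Armijo condition holds with step size $\alpha=1$, that is, $$f(x+p)\le f(x)+\rho\,\langle p,g(x)\rangle.$$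
   Context: Vector norms are Euclidean, matrix norms are spectral. When $L_2=0$ the upper bound on $\|g(x)\|$ is read as $+\infty$. Hessian-aware scaling selection: the inputs are a vector $g\in\mathbb{R}^d$, a symmetric matrix $H\in\mathbb{R}^{d\times d}$ and $\sigma>0$, with fixed constants $s^{\rm LPC}_{\min}\in(0,1/\sigma)$ and $0<s^{\rm NC}_{\min}\le s^{\rm NC}_{\max}<\infty$. It returns $p=-s\,g$, where: (SPC) if $\langle g,Hg\rangle>\sigma\|g\|^2$, then $s$ is any one of $s^{\rm MR}=\frac{\langle g,Hg\rangle}{\|Hg\|^2}$, $s^{\rm CG}=\frac{\|g\|^2}{\langle g,Hg\rangle}$, $s^{\rm GM}=\frac{\|g\|}{\|Hg\|}$; (LPC) if $0\le\langle g,Hg\rangle\le\sigma\|g\|^2$, then $s=s^{\rm LPC}$ is any number in $[s^{\rm LPC}_{\min},1/\sigma]$; (NC) if $\langle g,Hg\rangle<0$, then $s=s^{\rm NC}$ is any number in $[s^{\rm NC}_{\min},s^{\rm NC}_{\max}]$. *)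

(* Defs.v *)
From HB Require Import structures.
From mathcomp Require Import all_boot all_order all_algebra.
From mathcomp Require Import all_classical all_reals all_analysis.

Set Implicit Arguments.
Unset Strict Implicit.
Unset Printing Implicit Defensive.

Import Order.TTheory GRing.Theory Num.Theory.
Import numFieldNormedType.Exports.

Local Open Scope classical_set_scope.
Local Open Scope ring_scope.

Section Euclidean.
Context {R : realType} {d : nat}.
Implicit Types (u v : 'cV[R]_d) (A : 'M[R]_d).

Definition dot u v : R := (u^T *m v) 0 0.

(* The library norm `|u| on matrices is the max norm, hence these two norms. *)
Definition l2norm u : R := Num.sqrt (dot u u).

(* The operator norm induced by [l2norm]; using the closed unit ball instead
   of the unit sphere keeps the set nonempty when d = 0. *)
Definition spectral_norm A : R :=
  sup [set l2norm (A *m u) | u in [set u : 'cV[R]_d | l2norm u <= 1]].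

End Euclidean.

Section Differential.
Context {R : realType} {d : nat}.
Implicit Types (f : 'cV[R]_d -> R) (x : 'cV[R]_d).

Definition gradient f x : 'cV[R]_d := \col_i 'D_(delta_mx i 0) f x.

Definition hessian f x : 'M[R]_d :=
  \matrix_(i, j) 'D_(delta_mx j 0) (fun y => gradient f y i 0) x.

(* Differentiability is Frechet differentiability; it and continuity do not
   depend on the norm chosen on the finite-dimensional spaces involved. *)
Definition twice_continuously_differentiable f : Prop :=
  [/\ forall x, differentiable f x,
      forall x, differentiable (gradient f) x
    & continuous (hessian f)].

End Differential.

Section Scaling.
Context {R : realType} {d : nat}.
Variables (sLPCmin sNCmin sNCmax sigma : R) (g : 'cV[R]_d) (H : 'M[R]_d).

Variant hessian_aware_scaling : R -> Prop :=
  | SPC_MR of sigma * l2norm g ^+ 2 < dot g (H *m g) :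
      hessian_aware_scaling (dot g (H *m g) / l2norm (H *m g) ^+ 2)
  | SPC_CG of sigma * l2norm g ^+ 2 < dot g (H *m g) :
      hessian_aware_scaling (l2norm g ^+ 2 / dot g (H *m g))
  | SPC_GM of sigma * l2norm g ^+ 2 < dot g (H *m g) :
      hessian_aware_scaling (l2norm g / l2norm (H *m g))
  | LPC s of 0 <= dot g (H *m g) <= sigma * l2norm g ^+ 2
      & sLPCmin <= s <= 1 / sigma :
      hessian_aware_scaling s
  | NC s of dot g (H *m g) < 0 & sNCmin <= s <= sNCmax :
      hessian_aware_scaling s.

Definition hessian_aware_direction (p : 'cV[R]_d) : Prop :=
  exists2 s, hessian_aware_scaling s & p = - s *: g.

End Scaling.

(* Main.v *)
Require Import Defs.
From HB Require Import structures.
From mathcomp Require Import all_boot all_order all_algebra.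
From mathcomp Require Import all_classical all_reals all_analysis.
From mathcomp Require Import ring lra.

Set Implicit Arguments.
Unset Strict Implicit.
Unset Printing Implicit Defensive.

Import Order.TTheory GRing.Theory Num.Theory.
Import numFieldNormedType.Exports.

Local Open Scope classical_set_scope.
Local Open Scope ring_scope.

(** Restrict [f] to the ray from [x] along [- g], where [g] is the gradient at
    [x], and write [G] for the length of [g] and [c] for its curvature
    [dot g (H *m g)].  The derivatives at [0] of [t |-> f (x - t *: g)] are
    [- G ^+ 2] and [c], and the Lipschitz hypothesis on the Hessian says that
    the second derivative grows by at most [L2 * G ^+ 3 * t].  Integrating
    twice gives the cubic upper model ([descent_le])
      [f (x - s *: g) <= f x - s G^2 + s^2 c / 2 + L2 G^3 s^3 / 6],
    and the Armijo condition holds as soon as the quadratic and the cubic term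
    together use up at most the fraction [1 - rho] of the decrease [s G^2].

    When [c] is nonnegative, every admissible scaling satisfies
    [s * c <= G ^+ 2] and [s * sigma <= 1] ([nonneg_curvature_scaling]): under
    strong curvature the three candidates are ordered by Cauchy-Schwarz, the
    one called CG being the largest, and it turns the first bound into an
    equality.  So the quadratic term uses up at most half of the decrease, and
    the first bound on [G] makes the cubic term use up at most [1/2 - rho] of
    it.  When [c] is negative the quadratic term only helps, so that all of
    [1 - rho] is left for the cubic term; this is the second bound on [G],
    because [s <= sNCmax] ([negative_curvature_scaling]). *)

(** * Euclidean and spectral norms *)

Section Euclidean.
Context {R : realType} {d : nat}.
Implicit Types (u v w : 'cV[R]_d) (A : 'M[R]_d).

Lemma dotE u v : dot u v = \sum_i u i 0 * v i 0.
Proof. by rewrite /dot mxE; apply: eq_bigr => i _; rewrite mxE. Qed.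

Lemma dotC u v : dot u v = dot v u.
Proof. by rewrite !dotE; apply: eq_bigr => i _; rewrite mulrC. Qed.

Lemma dotDr u v w : dot u (v + w) = dot u v + dot u w.
Proof. by rewrite /dot mulmxDr mxE. Qed.

Lemma dotZr u v (a : R) : dot u (a *: v) = a * dot u v.
Proof. by rewrite /dot -scalemxAr mxE. Qed.

Lemma dotZl u v (a : R) : dot (a *: u) v = a * dot u v.
Proof. by rewrite dotC dotZr dotC. Qed.

Lemma dotNr u v : dot u (- v) = - dot u v.
Proof. by rewrite -[- v]scaleN1r dotZr mulN1r. Qed.

Lemma dotNl u v : dot (- u) v = - dot u v.
Proof. by rewrite dotC dotNr dotC. Qed.

Lemma dotBl u v w : dot (u - v) w = dot u w - dot v w.
Proof. by rewrite dotC dotDr dotNr 2!(dotC w). Qed.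

Lemma dotBr u v w : dot u (v - w) = dot u v - dot u w.
Proof. by rewrite dotC dotBl 2!(dotC u). Qed.

Lemma dotvv_ge0 u : 0 <= dot u u.
Proof. by rewrite dotE; apply: sumr_ge0 => i _; rewrite -expr2 sqr_ge0. Qed.

Lemma dotvv_eq0 u : (dot u u == 0) = (u == 0).
Proof.
apply/idP/eqP => [|->]; last by rewrite dotE big1 // => i _; rewrite mxE mul0r.
rewrite dotE psumr_eq0 => [/allP u0|i _]; last by rewrite -expr2 sqr_ge0.
apply/colP => i; have := u0 i (mem_index_enum i).
by rewrite mulf_eq0 orbb mxE => /eqP.
Qed.

Lemma l2norm_ge0 u : 0 <= l2norm u.
Proof. exact: sqrtr_ge0. Qed.

Lemma l2norm_sqr u : l2norm u ^+ 2 = dot u u.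
Proof. by rewrite sqr_sqrtr // dotvv_ge0. Qed.

Lemma l2norm_eq0 u : (l2norm u == 0) = (u == 0).
Proof. by rewrite -sqrf_eq0 l2norm_sqr dotvv_eq0. Qed.

Lemma l2normZ (a : R) u : l2norm (a *: u) = `|a| * l2norm u.
Proof.
by rewrite /l2norm dotZl dotZr mulrA -expr2 sqrtrM ?sqr_ge0 // sqrtr_sqr.
Qed.

(** The difference between the two sides, times [dot v v], is the squared
    length of [dot v v *: u - dot u v *: v]. *)
Lemma cauchy_schwarz_sqr u v : dot u v ^+ 2 <= dot u u * dot v v.
Proof.
have [/eqP v0|vN0] := boolP (v == 0).
  by rewrite v0 -(scale0r 0) !dotZr !mul0r mulr0 expr0n.
have v_gt0 : 0 < dot v v by rewrite lt_def dotvv_eq0 vN0 dotvv_ge0.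
have := dotvv_ge0 (dot v v *: u - dot u v *: v).
rewrite dotBl !dotBr !dotZl !dotZr (dotC v u) => H.
have {}H : 0 <= dot v v * (dot u u * dot v v - dot u v ^+ 2).
  by apply: le_trans H _; rewrite le_eqVlt; apply/orP; left; apply/eqP; ring.
by rewrite -subr_ge0 -(pmulr_rge0 _ v_gt0).
Qed.

Lemma cauchy_schwarz u v : dot u v <= l2norm u * l2norm v.
Proof.
rewrite (le_trans (ler_norm _)) // -sqrtr_sqr -sqrtrM ?dotvv_ge0 //.
exact/ler_wsqrtr/cauchy_schwarz_sqr.
Qed.

(** [sup] only bounds a set that has an upper bound; here the Frobenius norm
    is one, by Cauchy-Schwarz on each row. *)
Lemma l2norm_mulmx_bounded A :
  has_ubound [set l2norm (A *m u) | u in [set u : 'cV[R]_d | l2norm u <= 1]].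
Proof.
exists (Num.sqrt (\sum_i dot (row i A)^T (row i A)^T)) => _ [u /= u1 <-].
apply: ler_wsqrtr; rewrite dotE; apply: ler_sum => i _.
have -> : (A *m u) i 0 = dot (row i A)^T u.
  by rewrite /dot trmxK -row_mul [in RHS]mxE.
rewrite -expr2; apply: le_trans (cauchy_schwarz_sqr _ _) _.
rewrite -[leRHS]mulr1 ler_wpM2l ?dotvv_ge0 // -l2norm_sqr.
by rewrite expr_le1 ?l2norm_ge0.
Qed.

Lemma l2norm_mulmx_le A u : l2norm (A *m u) <= spectral_norm A * l2norm u.
Proof.
have [/eqP u0|uN0] := boolP (u == 0).
  have z : l2norm (0 : 'cV[R]_d) = 0 by apply/eqP; rewrite l2norm_eq0.
  by rewrite u0 mulmx0 z mulr0.
have u_gt0 : 0 < l2norm u by rewrite lt_def l2norm_eq0 uN0 l2norm_ge0.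
rewrite -ler_pdivrMr //; apply: (ub_le_sup (l2norm_mulmx_bounded A)).
have ui0 : 0 <= (l2norm u)^-1 by rewrite invr_ge0 ltW.
exists ((l2norm u)^-1 *: u) => /=.
  by rewrite l2normZ ger0_norm // mulVf ?gt_eqF.
by rewrite -scalemxAr l2normZ ger0_norm // mulrC.
Qed.

Lemma dot_mulmx_le A u : dot u (A *m u) <= spectral_norm A * l2norm u ^+ 2.
Proof.
apply: le_trans (cauchy_schwarz _ _) _.
by rewrite expr2 mulrA mulrC ler_wpM2r ?l2norm_ge0 ?l2norm_mulmx_le.
Qed.

End Euclidean.

(** * Taylor bound of order two in one variable *)

Section OneVariable.
Context {R : realType}.
Implicit Types (u du : R -> R).

Lemma le_of_derive_ge0 u du (s : R) :
    (forall t : R, is_derive t 1 u (du t)) ->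
    (forall t, 0 <= t <= s -> 0 <= du t) -> 0 <= s ->
  u 0 <= u s.
Proof.
move=> u_du du_ge0 s_ge0.
apply: (@ger0_derive1_ndecr _ u 0 s) => //.
- by move=> t t_in; rewrite derive1E derive_val du_ge0 // !ltW ?(itvP t_in).
- apply: continuous_subspaceT => t.
  exact/differentiable_continuous/derivable1_diffP.
Qed.

(** Monotonicity, applied first to [dphi] and then to [phi], plays the role of
    integrating the bound on [d2phi] twice. *)
Lemma taylor2_le (phi dphi d2phi : R -> R) (K s : R) :
    (forall t : R, is_derive t 1 phi (dphi t)) ->
    (forall t : R, is_derive t 1 dphi (d2phi t)) ->
    (forall t, 0 <= t -> d2phi t <= d2phi 0 + K * t) -> 0 <= s ->
  phi s <= phi 0 + dphi 0 * s + d2phi 0 / 2 * s ^+ 2 + K / 6 * s ^+ 3.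
Proof.
move=> phiP dphiP d2phi_le s_ge0.
have dphi_le t : 0 <= t -> dphi t <= dphi 0 + d2phi 0 * t + K / 2 * t ^+ 2.
  move=> t_ge0; have := @le_of_derive_ge0
    (fun t => dphi 0 + d2phi 0 * t + K / 2 * t ^+ 2 - dphi t)
    (fun t => d2phi 0 + K * t - d2phi t) t.
  rewrite !mulr0 expr0n mulr0 !addr0 subrr subr_ge0; apply => // [r|r /andP[? _]].
    by apply: is_derive_eq; rewrite /GRing.scale /=; field.
  by rewrite subr_ge0 d2phi_le.
have := @le_of_derive_ge0
    (fun t => phi 0 + dphi 0 * t + d2phi 0 / 2 * t ^+ 2 + K / 6 * t ^+ 3 - phi t)
    (fun t => dphi 0 + d2phi 0 * t + K / 2 * t ^+ 2 - dphi t) s.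
rewrite !expr0n !mulr0 !addr0 subrr subr_ge0; apply => // [r|r /andP[? _]].
  by apply: is_derive_eq; rewrite /GRing.scale /=; field.
by rewrite subr_ge0 dphi_le.
Qed.

End OneVariable.

(** * Derivatives along a line *)

Section Line.
Context {R : realType} {d : nat}.
Implicit Types (f : 'cV[R]_d -> R) (x v : 'cV[R]_d).

Lemma derive_gradient f x v : differentiable f x -> 'D_v f x = dot (gradient f x) v.
Proof.
move=> df; rewrite deriveE // {1}[v]matrix_sum_delta linear_sum dotE /=.
apply: eq_bigr => i _.
by rewrite big_ord1 linearZ /= mxE deriveE // mulrC.
Qed.

Lemma is_derive_line f x v (t : R) :
    (forall y, differentiable f y) ->
  is_derive t 1 (fun t => f (x + t *: v)) (dot (gradient f (x + t *: v)) v).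
Proof.
move=> df.
(* The difference quotient of the restriction is that of [f] along [v]. *)
have E : (fun h : R => h^-1 *: (f (x + (h *: 1 + t) *: v) - f (x + t *: v))) =
         (fun h : R => h^-1 *: (f (h *: v + (x + t *: v)) - f (x + t *: v))).
  apply/funext => h; congr (_ *: (f _ - _)).
  by rewrite [h *: 1]mulr1 scalerDl addrCA.
have dv : derivable f (x + t *: v) v by exact: diff_derivable.
rewrite -(derive_gradient v (df (x + t *: v))); apply: DeriveDef.
  by rewrite /derivable E.
by rewrite /derive E.
Qed.

Lemma differentiable_coord_comp (F : 'cV[R]_d -> 'cV[R]_d) (i : 'I_d) x :
  differentiable F x -> differentiable (fun y => F y i 0 : R) x.
Proof.
move=> dF.
have dcoord : differentiable (fun v : 'cV[R]_d => v i 0) (F x).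
  exact: differentiable_coord.
exact: (differentiable_comp dF dcoord).
Qed.

(** Row [i] of the Hessian is the gradient of the [i]-th partial derivative, so
    [is_derive_line] applies to each component of the gradient. *)
Lemma is_derive_gradient_line f x v (t : R) :
    (forall y, differentiable (gradient f) y) ->
  is_derive t 1 (fun t => dot (gradient f (x + t *: v)) v)
                (dot v (hessian f (x + t *: v) *m v)).
Proof.
move=> df.
have -> : (fun t => dot (gradient f (x + t *: v)) v) =
    \sum_i (fun t => v i 0 *: gradient f (x + t *: v) i 0).
  apply/funext => r; rewrite dotE fct_sumE.
  by apply: eq_bigr => i _; rewrite mulrC.
rewrite dotE; apply: is_derive_sum => i.
apply: is_deriveZ.
have -> : (hessian f (x + t *: v) *m v) i 0 =
          dot (gradient (fun y => gradient f y i 0) (x + t *: v)) v.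
  by rewrite mxE dotE; apply: eq_bigr => j _; rewrite !mxE.
apply: is_derive_line => y.
exact/differentiable_coord_comp.
Qed.

End Line.

(** * Cubic upper model along a ray *)

Lemma taylor2_line_le (R : realType) (d : nat) (f : 'cV[R]_d -> R)
    (x v : 'cV[R]_d) (K s : R) :
    (forall y, differentiable f y) ->
    (forall y, differentiable (gradient f) y) ->
    (forall t, 0 <= t ->
       dot v (hessian f (x + t *: v) *m v) <= dot v (hessian f x *m v) + K * t) ->
    0 <= s ->
  f (x + s *: v) <= f x + dot (gradient f x) v * s
                    + dot v (hessian f x *m v) / 2 * s ^+ 2 + K / 6 * s ^+ 3.
Proof.
move=> df dgf hess_le s_ge0.
have := @taylor2_le R _ _ _ K s
  (fun t => is_derive_line x v t df)
  (fun t => is_derive_gradient_line x v t dgf).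
by rewrite /= scale0r addr0; apply.
Qed.

(** The cubic upper model.  The variation of the curvature along the ray is the
    quadratic form of a difference of Hessians, hence bounded by its spectral
    norm. *)
Lemma descent_le (R : realType) (d : nat) (f : 'cV[R]_d -> R)
    (x v : 'cV[R]_d) (L s : R) :
    (forall y, differentiable f y) ->
    (forall y, differentiable (gradient f) y) ->
    (forall t, 0 <= t ->
       spectral_norm (hessian f (x - t *: v) - hessian f x) <= t * L) ->
    0 <= s ->
  f (x - s *: v) <= f x - s * dot (gradient f x) v
                    + s ^+ 2 * dot v (hessian f x *m v) / 2
                    + L * l2norm v ^+ 2 * s ^+ 3 / 6.
Proof.
move=> df dgf hess_lip s_ge0.
have quadN (A : 'M[R]_d) : dot (- v) (A *m - v) = dot v (A *m v).
  by rewrite mulmxN dotNl dotNr opprK.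
have := @taylor2_line_le R d f x (- v) (L * l2norm v ^+ 2) s df dgf.
(* From here on only the bound on the Hessians matters, not what they are. *)
move: (gradient f x) (hessian f) hess_lip => g H hess_lip Taylor.
apply: le_trans.
  rewrite -scalerN; apply: Taylor => // t t_ge0.
  rewrite scalerN !quadN -lerBlDl -dotBr -mulmxBl.
  apply: le_trans (dot_mulmx_le _ _) _.
  apply: le_trans (ler_wpM2r (sqr_ge0 _) (hess_lip t t_ge0)) _.
  by rewrite le_eqVlt; apply/orP; left; apply/eqP; ring.
by rewrite quadN dotNr le_eqVlt; apply/orP; left; apply/eqP; field.
Qed.

(** [kappa] is the share of the linear decrease [s * G ^+ 2] that the quadratic
    term may cancel; the bound on [L] leaves the share [1 - kappa - rho] to the
    cubic term. *)
Lemma cubic_model_decrease (R : realType) (s G c L rho kappa : R) :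
    0 <= s -> s * c / 2 <= kappa * G ^+ 2 -> L * G * s ^+ 2 <= 6 * (1 - kappa - rho) ->
  - (s * G ^+ 2) + s ^+ 2 * c / 2 + L * G ^+ 3 * s ^+ 3 / 6 <= - (rho * s * G ^+ 2).
Proof.
move=> s_ge0 c_le L_le.
have cM := ler_wpM2l s_ge0 c_le.
have LM := ler_wpM2l (mulr_ge0 s_ge0 (sqr_ge0 G)) L_le.
have -> : s ^+ 2 * c / 2 = s * (s * c / 2) by ring.
have -> : L * G ^+ 3 * s ^+ 3 / 6 = s * G ^+ 2 * (L * G * s ^+ 2) / 6 by ring.
lra.
Qed.

(** For [b = 0] the conclusion is [0 <= a]: multiplied out, the bound on the
    gradient has no special case. *)
Lemma ediv_le (R : realType) (G a b : R) :
  0 <= a -> 0 <= b -> (G%:E <= a%:E / b%:E)%E -> b * G <= a.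
Proof.
move=> a_ge0; rewrite le_eqVlt => /predU1P[<-|b_gt0]; first by rewrite mul0r.
by rewrite inver gt_eqF // -EFinM lee_fin ler_pdivlMr // mulrC.
Qed.

(** * Bounds on the scaling *)

(** Under strong curvature [s * c <= G ^+ 2] comes from Cauchy-Schwarz, used
    squared for MR and as is for GM, and it implies [s * sigma <= 1] since
    [sigma * G ^+ 2 < c].  Under limited curvature the implication goes the
    other way. *)
Lemma nonneg_curvature_scaling (R : realType) (d : nat)
    (sLPCmin sNCmin sNCmax sigma : R) (g : 'cV[R]_d) (H : 'M[R]_d) (s : R) :
    0 < sigma -> 0 <= sLPCmin ->
    hessian_aware_scaling sLPCmin sNCmin sNCmax sigma g H s ->
    0 <= dot g (H *m g) ->
  [/\ 0 <= s, s * sigma <= 1 & s * dot g (H *m g) <= l2norm g ^+ 2].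
Proof.
move=> sigma_gt0 sLPC_ge0 scal c_ge0.
set c := dot g (H *m g) in c_ge0 scal *.
set G := l2norm g in scal *; set h := l2norm (H *m g) in scal.
have G_ge0 : 0 <= G := l2norm_ge0 g.
have h_ge0 : 0 <= h := l2norm_ge0 (H *m g).
have c_le : c <= G * h := cauchy_schwarz _ _.
have SPC r : sigma * G ^+ 2 < c -> 0 <= r -> r * c <= G ^+ 2 ->
    [/\ 0 <= r, r * sigma <= 1 & r * c <= G ^+ 2].
  move=> c_gt r_ge0 rc; split=> //.
  have c_gt0 : 0 < c by rewrite (le_lt_trans _ c_gt) // mulr_ge0 ?sqr_ge0 // ltW.
  have G_gt0 : 0 < G.
    by rewrite lt_def G_ge0 andbT; apply: contraTneq c_le => ->; rewrite mul0r -ltNge.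
  rewrite -(ler_pM2r (exprn_gt0 2 G_gt0)) mul1r -mulrA (le_trans _ rc) //.
  by rewrite ler_wpM2l // ltW.
have h_gt0 : sigma * G ^+ 2 < c -> 0 < c /\ 0 < h.
  move=> c_gt.
  have c_gt0 : 0 < c by rewrite (le_lt_trans _ c_gt) // mulr_ge0 ?sqr_ge0 // ltW.
  split=> //.
  by rewrite lt_def h_ge0 andbT; apply: contraTneq c_le => ->; rewrite mulr0 -ltNge.
case: scal => [c_gt|c_gt|c_gt|r /andP[_ c_small] /andP[r_ge r_le]|r c_lt0 _].
- have [c0 h0] := h_gt0 c_gt; apply: SPC => //.
    by rewrite divr_ge0 ?exprn_ge0.
  by rewrite mulrAC ler_pdivrMr ?exprn_gt0 // -expr2 -exprMn ler_sqr ?nnegrE ?mulr_ge0.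
- have [c0 h0] := h_gt0 c_gt; apply: SPC => //.
    by rewrite divr_ge0 ?exprn_ge0.
  by rewrite divfK ?gt_eqF.
- have [c0 h0] := h_gt0 c_gt; apply: SPC => //.
    by rewrite divr_ge0.
  by rewrite mulrAC ler_pdivrMr // expr2 -mulrA ler_wpM2l.
- have r_ge0 : 0 <= r := le_trans sLPC_ge0 r_ge.
  have rs : r * sigma <= 1 by rewrite -ler_pdivlMr.
  split=> //; apply: le_trans (ler_wpM2l r_ge0 c_small) _.
  by rewrite mulrA -[leRHS]mul1r ler_wpM2r ?sqr_ge0.
- by move: c_lt0; rewrite ltNge c_ge0.
Qed.

Lemma negative_curvature_scaling (R : realType) (d : nat)
    (sLPCmin sNCmin sNCmax sigma : R) (g : 'cV[R]_d) (H : 'M[R]_d) (s : R) :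
    0 <= sigma ->
    hessian_aware_scaling sLPCmin sNCmin sNCmax sigma g H s ->
    dot g (H *m g) < 0 ->
  sNCmin <= s <= sNCmax.
Proof.
move=> sigma_ge0 scal c_lt0.
have not_SPC : ~ (sigma * l2norm g ^+ 2 < dot g (H *m g)).
  by apply/negP; rewrite -leNgt (le_trans (ltW c_lt0)) // mulr_ge0 ?sqr_ge0.
by case: scal => [//|//|//|r /andP[]|//]; rewrite leNgt c_lt0.
Qed.

(** * The Armijo condition *)

(* In the bound on the gradient, division is that of extended reals, for which
   a positive real divided by 0 is +oo. *)
Theorem theorem3p3 (R : realType) (d : nat) (f : 'cV[R]_d -> R)
    (L2 rho sigma sLPCmin sNCmin sNCmax : R) (x p : 'cV[R]_d)
    (f_C2 : twice_continuously_differentiable f)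
    (f_bounded_below : has_lbound (range f))
    (L2_ge0 : 0 <= L2)
    (hessian_lipschitz : forall (y : 'cV[R]_d) (t : R), 0 <= t ->
       spectral_norm (hessian f (y - t *: gradient f y) - hessian f y)
         <= t * L2 * l2norm (gradient f y))
    (rho_itv : 0 < rho < 1 / 2)
    (sigma_gt0 : 0 < sigma)
    (sLPCmin_itv : 0 < sLPCmin < 1 / sigma)
    (sNCmin_gt0 : 0 < sNCmin)
    (sNCmin_le_sNCmax : sNCmin <= sNCmax)
    (p_dir : hessian_aware_direction sLPCmin sNCmin sNCmax sigma
               (gradient f x) (hessian f x) p)
    (gradient_small : ((l2norm (gradient f x))%:E <=
       Order.min ((6 * sigma ^+ 2 * (1 / 2 - rho))%:E / L2%:E)
                 ((6 * (1 - rho))%:E / (L2 * sNCmax ^+ 2)%:E))%E) :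
  f (x + p) <= f x + rho * dot p (gradient f x).
Proof.
case: f_C2 => df dgf _; case/andP: rho_itv => rho_gt0 rho_lt.
case/andP: sLPCmin_itv => /ltW sLPCmin_ge0 _.
case: p_dir => s scal ->.
move: gradient_small; rewrite le_min => /andP[].
move=> /ediv_le small_sigma /ediv_le small_NC.
rewrite dotZl -l2norm_sqr scaleNr mulNr mulrN.
set g := gradient f x in scal small_sigma small_NC *.
set G := l2norm g in small_sigma small_NC *.
set c := dot g (hessian f x *m g).
have G_ge0 : 0 <= G := l2norm_ge0 g.
suff [s_ge0 [kappa c_le L_le]] : 0 <= s /\ exists2 kappa,
    s * c / 2 <= kappa * G ^+ 2 & L2 * G * s ^+ 2 <= 6 * (1 - kappa - rho).
  have lip t : 0 <= t ->
      spectral_norm (hessian f (x - t *: g) - hessian f x) <= t * (L2 * G).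
    by rewrite mulrA; apply: hessian_lipschitz.
  apply: le_trans (descent_le df dgf lip s_ge0) _.
  rewrite -/g -/c -/G -l2norm_sqr -/G -!addrA lerD2l !addrA [rho * _]mulrA.
  have -> : L2 * G * G ^+ 2 = L2 * G ^+ 3 by ring.
  exact: cubic_model_decrease c_le L_le.
have LG_ge0 : 0 <= L2 * G by rewrite mulr_ge0.
have [c_lt0|c_ge0] := ltP c 0.
  have /andP[s_ge s_le] := negative_curvature_scaling (ltW sigma_gt0) scal c_lt0.
  have s_ge0 : 0 <= s by rewrite (le_trans _ s_ge) // ltW.
  split=> //; exists 0.
    by rewrite mul0r mulr_le0_ge0 ?invr_ge0 // mulr_ge0_le0 // ltW.
  rewrite subr0; apply: le_trans (small_NC _ _).
  - rewrite [L2 * _ * G]mulrAC ler_wpM2l // ler_sqr ?nnegrE //.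
    exact: le_trans s_le.
  - by lra.
  - by rewrite mulr_ge0 ?sqr_ge0.
have [s_ge0 s_sigma sc] := nonneg_curvature_scaling sigma_gt0 sLPCmin_ge0 scal c_ge0.
rewrite -/c -/G in sc.
split=> //; exists (1 / 2); first by lra.
have -> : 6 * (1 - 1 / 2 - rho) = 6 * (1 / 2 - rho) by field.
have a_ge0 : 0 <= 6 * (1 / 2 - rho) by lra.
have {}small_sigma : L2 * G <= 6 * sigma ^+ 2 * (1 / 2 - rho).
  by apply: small_sigma => //; rewrite mulrAC mulr_ge0 ?sqr_ge0.
apply: le_trans (ler_wpM2r (sqr_ge0 s) small_sigma) _.
have -> : 6 * sigma ^+ 2 * (1 / 2 - rho) * s ^+ 2 = 6 * (1 / 2 - rho) * (s * sigma) ^+ 2.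
  by ring.
by rewrite -[leRHS]mulr1 ler_wpM2l // expr_le1 ?mulr_ge0 // ltW.
Qed.
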